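(* Let $R$ be a unital commutative ring. Then $M(R)=\bigsqcup_{I\trianglelefteq R}R/I$ (disjoint union over all ideals $I$ of $R$), with the operations defined by $$(x+I)+(y+J)=(x+y)+(I+J),\qquad (x+I)\cdot(y+J)=(x\cdot y)+(I+J),\qquad -(x+I)=-x+I,$$ is a pre-meadow with $\mathbf{a}$. Furthermore, if $R$ is Artinian then $M(R)$ is a common meadow.
   Context: A pre-meadow is a structure $(P,+,-,\cdot)$ with constants $0,1$ such that for all $x,y,z\in P$: $(x+y)+z=x+(y+z)$; $x+y=y+x$; $x+0=x$; $x+(-x)=0\cdot x$; $(x\cdot y)\cdot z=x\cdot(y\cdot z)$; $x\cdot y=y\cdot x$; $1\cdot x=x$; $x\cdot(y+z)=x\cdot y+x\cdot z$; $-(-x)=x$; $0\cdot(x+y)=0\cdot x\cdot y$. Write $0\cdot P=\{0\cdot x\mid x\in P\}$ and, for $z\in 0\cdot P$, $P_z=\{x\in P\mid 0\cdot x=z\}$. $P$ is a pre-meadow with $\mathbf{a}$ if there is a unique $z\in 0\cdot P$ with $|P_z|=1$ (this $z$ is denoted $\mathbf{a}$) and $x+\mathbf{a}=\mathbf{a}$ for all $x\in P$. A common meadow is a pre-meadow with $\mathbf{a}$ equipped with an inverse function $x\mapsto x^{-1}$ satisfying $x\cdot x^{-1}=1+0\cdot x^{-1}$, $(x\cdot y)^{-1}=x^{-1}\cdot y^{-1}$, $(1+0\cdot x)^{-1}=1+0\cdot x$, and $0^{-1}=\mathbf{a}$; saying that a pre-meadow with $\mathbf{a}$ is a common meadow means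 that such an inverse function exists. In $M(R)$ the constants are $0=0+(0)$ and $1=1+(0)$ in $R/(0)$, and $\mathbf{a}$ is the unique element of $R/R$. A ring is Artinian if every descending sequence of ideals eventually stabilizes. *)

(* Defs.v *)
From HB Require Import structures.
From mathcomp Require Import all_boot ssralg generic_quotient ring_quotient.
From mathcomp Require Import boolp classical_sets cardinality.

Set Implicit Arguments.
Unset Strict Implicit.
Unset Printing Implicit Defensive.

Import GRing.Theory.
Import Quotient.

Local Open Scope ring_scope.

(* Pre-meadows and common meadows *)

Record meadow_sig := MeadowSig {
  mcarrier :> Type;
  madd : mcarrier -> mcarrier -> mcarrier;
  mopp : mcarrier -> mcarrier;
  mmul : mcarrier -> mcarrier -> mcarrier;
  mzero : mcarrier;
  mone : mcarrier }.

Arguments mzero {_}.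
Arguments mone {_}.

Declare Scope meadow_scope.
Delimit Scope meadow_scope with Mdw.
Bind Scope meadow_scope with mcarrier.
Notation "x + y" := (madd x y) : meadow_scope.
Notation "- x" := (mopp x) : meadow_scope.
Notation "x * y" := (mmul x y) : meadow_scope.
Notation "0" := mzero : meadow_scope.
Notation "1" := mone : meadow_scope.

Section Meadows.
Local Open Scope meadow_scope.
Variable P : meadow_sig.

Record pre_meadow : Prop := PreMeadow {
  pm_addA : forall x y z : P, (x + y) + z = x + (y + z);
  pm_addC : forall x y : P, x + y = y + x;
  pm_addr0 : forall x : P, x + 0 = x;
  pm_addrN : forall x : P, x + (- x) = 0 * x;
  pm_mulA : forall x y z : P, (x * y) * z = x * (y * z);
  pm_mulC : forall x y : P, x * y = y * x;
  pm_mul1r : forall x : P, 1 * x = x;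
  pm_mulDr : forall x y z : P, x * (y + z) = x * y + x * z;
  pm_oppK : forall x : P, - (- x) = x;
  pm_mul0D : forall x y : P, 0 * (x + y) = 0 * x * y }.

Definition zero_set : set P := [set 0 * x | x in [set: P]]%classic.

Definition zero_fiber (z : P) : set P := [set x | 0 * x = z]%classic.

Definition singleton_fiber (z : P) : Prop :=
  zero_set z /\ (zero_fiber z #= `I_1)%card.

(* [a] is a parameter rather than existentially quantified, so that it can be
   named in concrete examples and in the axiom [0^-1 = a]; it is determined
   by [P] because of the clause [unique]. *)
Definition pre_meadow_with (a : P) : Prop :=
  [/\ pre_meadow, unique singleton_fiber a & forall x : P, x + a = a].

Record meadow_inverse (a : P) (inv : P -> P) : Prop := MeadowInverse {
  mi_mulV : forall x : P, x * inv x = 1 + 0 * inv x;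
  mi_invM : forall x y : P, inv (x * y) = inv x * inv y;
  mi_inv1D : forall x : P, inv (1 + 0 * x) = 1 + 0 * x;
  mi_inv0 : inv 0 = a }.

Definition common_meadow (a : P) : Prop :=
  pre_meadow_with a /\ exists inv : P -> P, meadow_inverse a inv.

End Meadows.

Arguments pre_meadow_with : clear implicits.
Arguments common_meadow : clear implicits.

(* Ideals.  MathComp's [idealr] only covers proper ideals of nontrivial rings,
   whereas here the unit ideal and the zero ring are allowed. *)

Record ideal (R : comPzRingType) := Ideal {
  ideal_mem :> {pred R};
  ideal_zmod : zmod_closed ideal_mem;
  ideal_mull : forall a, {in ideal_mem, forall u, a * u \in ideal_mem} }.

HB.instance Definition _ (R : comPzRingType) (I : ideal R) :=
  GRing.isZmodClosed.Build R (ideal_mem I) (ideal_zmod I).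

Definition artinian (R : comPzRingType) : Prop :=
  forall I : nat -> ideal R,
    (forall n, {subset I n.+1 <= I n}) ->
    exists N, forall n, (N <= n)%N -> I n =i I N.

Section IdealOps.
Variable R : comPzRingType.
Implicit Types I J : ideal R.

Lemma ideal_eq I J : I =i J -> I = J.
Proof.
case: I J => [I Iz Im] [J Jz Jm] /= eqIJ.
have {}eqIJ : I = J by apply/funext => x; exact: eqIJ x.
by subst J; congr Ideal; exact: Prop_irrelevance.
Qed.

Fact ideal0_zmod : zmod_closed (pred1 (0 : R)).
Proof.
split=> [|x y]; rewrite !inE // => /eqP-> /eqP->.
by rewrite subr0.
Qed.

Fact ideal0_mull a : {in pred1 (0 : R), forall u, a * u \in pred1 (0 : R)}.
Proof. by move=> u; rewrite !inE => /eqP->; rewrite mulr0. Qed.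

Definition ideal0 : ideal R := Ideal ideal0_zmod ideal0_mull.

Definition ideal1 : ideal R :=
  @Ideal R predT (conj isT (fun _ _ _ _ => isT)) (fun _ _ _ => isT).

Definition ideal_add_mem I J : {pred R} :=
  [pred x | `[< exists2 i, i \in I & exists2 j, j \in J & x = i + j >]].

Fact ideal_add_zmod I J : zmod_closed (ideal_add_mem I J).
Proof.
split=> [|x y]; rewrite !inE.
  by exists 0; rewrite ?rpred0 //; exists 0; rewrite ?rpred0 ?addr0.
move=> [i Ii [j Jj ->]] [k Ik [l Jl ->]].
exists (i - k); first by rewrite rpredB.
by exists (j - l); [rewrite rpredB | rewrite opprD addrACA].
Qed.

Fact ideal_add_mull I J a :
  {in ideal_add_mem I J, forall u, a * u \in ideal_add_mem I J}.
Proof.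
move=> u; rewrite !inE => -[i Ii [j Jj ->]].
exists (a * i); first exact: ideal_mull.
by exists (a * j); [exact: ideal_mull | rewrite mulrDr].
Qed.

Definition ideal_add I J : ideal R :=
  Ideal (ideal_add_zmod I J) (@ideal_add_mull I J).

Lemma ideal_addP I J x :
  reflect (exists2 i, i \in I & exists2 j, j \in J & x = i + j)
          (x \in ideal_add I J).
Proof. exact: asboolP. Qed.

End IdealOps.

(* The disjoint union of the quotients R/I *)

Section DisjointQuotients.
Variable R : comPzRingType.

Definition qunion : Type := {I : ideal R & {quot I}}.

Definition qclass (I : ideal R) (x : R) : qunion :=
  existT (fun I : ideal R => {quot I}) I (\pi_{quot I}%qT x).

(* These are defined on representatives; independence of the representatives
   is [qaddE], [qmulE] and [qoppE]. *)
Definition qadd (u v : qunion) : qunion :=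
  qclass (ideal_add (tag u) (tag v)) (repr (tagged u) + repr (tagged v)).

Definition qmul (u v : qunion) : qunion :=
  qclass (ideal_add (tag u) (tag v)) (repr (tagged u) * repr (tagged v)).

Definition qopp (u : qunion) : qunion := qclass (tag u) (- repr (tagged u)).

Lemma qclass_eq (I : ideal R) (x y : R) : x - y \in I -> qclass I x = qclass I y.
Proof.
by move=> Ixy; congr existT; apply/eqP; rewrite -idealrBE.
Qed.

Lemma repr_qclass (I : ideal R) (x : R) :
  repr (tagged (qclass I x)) - x \in I.
Proof. by rewrite idealrBE reprK. Qed.

Lemma qaddE (I J : ideal R) (x y : R) :
  qadd (qclass I x) (qclass J y) = qclass (ideal_add I J) (x + y).
Proof.
apply: qclass_eq; apply/ideal_addP.
exists (repr (tagged (qclass I x)) - x); first exact: repr_qclass.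
exists (repr (tagged (qclass J y)) - y); first exact: repr_qclass.
by rewrite opprD addrACA.
Qed.

Lemma qmulE (I J : ideal R) (x y : R) :
  qmul (qclass I x) (qclass J y) = qclass (ideal_add I J) (x * y).
Proof.
apply: qclass_eq; apply/ideal_addP; rewrite /tag /=.
set x' := repr _; set y' := repr _.
exists (y' * (x' - x)); first by apply: ideal_mull; exact: repr_qclass.
exists (x * (y' - y)); first by apply: ideal_mull; exact: repr_qclass.
by rewrite !mulrBr [y' * x']mulrC [y' * x]mulrC addrA subrK.
Qed.

Lemma qoppE (I : ideal R) (x : R) : qopp (qclass I x) = qclass I (- x).
Proof.
by apply: qclass_eq; rewrite -opprD rpredN; exact: repr_qclass.
Qed.

Lemma qclassP (u : qunion) : exists I x, u = qclass I x.
Proof. by case: u => I q; exists I, (repr q); rewrite /qclass reprK. Qed.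

Definition qmeadow : meadow_sig := {|
  mcarrier := qunion;
  madd := qadd;
  mopp := qopp;
  mmul := qmul;
  mzero := qclass (ideal0 R) 0;
  mone := qclass (ideal0 R) 1 |}.

Definition qmeadow_a : qmeadow := qclass (ideal1 R) 0.

End DisjointQuotients.

(* Main.v *)
Require Import Defs.
From mathcomp Require Import all_boot ssralg.
From mathcomp Require Import ring_quotient boolp classical_sets.
From mathcomp Require Import cardinality.

(** Ideals of [R] form a join-semilattice under sum, with least element [(0)],
    and the operations of the disjoint union act by joining the ideals and
    computing on representatives; so each pre-meadow law is a ring identity on
    representatives together with a semilattice identity on ideals.
    Multiplication by [0] sends [x + I] to [0 + I], so the zero elements are
    in bijection with the ideals, and the fibre over [0 + I] is [R/I].  It has
    one element exactly when [I = R], which singles out [a].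

    For the inverse, call [w] an inverse of [u] with error if
    [u * w = 1 + 0 * w]: for [u = x + I] and [w = z + J] this says that [J]
    contains [I] and that [z] inverts [x] modulo [J].  In any pre-meadow such a
    [w] is determined by [u] and [0 * w].  If every [u] has such an inverse with
    the least possible [0 * w], the property of being this least inverse is
    multiplicative, and the choice of least inverses satisfies the axioms of a
    common meadow ([common_meadow_of_least_inverses]).

    It remains to see that, for [R] Artinian, the ideals [J] above [I] modulo
    which [x] is invertible have a least element.  The chain of the ideals
    [(x ^ n)] stabilizes, so [x ^ n * (1 - x * r) = 0] for some [n] and [r]
    ([artinian_strongly_pi_regular]).  If [x] is invertible modulo [J], then so
    is [x ^ n], whence [1 - x * r] lies in [J]; conversely [r] inverts [x]
    modulo every [J] that contains [1 - x * r].  The least ideal is therefore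
    [I + (1 - x * r)]. *)

Set Implicit Arguments.
Unset Strict Implicit.
Unset Printing Implicit Defensive.

Import GRing.Theory.

(** * Least inverses in a pre-meadow *)

Section LeastInverses.
Local Open Scope meadow_scope.
Variables (P : meadow_sig) (pmP : pre_meadow P).
Implicit Types u v w x y : P.

Let addA := pm_addA pmP.
Let addC := pm_addC pmP.
Let addr0 := pm_addr0 pmP.
Let mulA := pm_mulA pmP.
Let mulC := pm_mulC pmP.
Let mul1r := pm_mul1r pmP.
Let mulDr := pm_mulDr pmP.
Let mul0D := pm_mul0D pmP.

Lemma pm_mulr1 x : x * 1 = x.
Proof. by rewrite mulC mul1r. Qed.

Lemma pm_mulCA x y z : x * (y * z) = y * (x * z).
Proof. by rewrite -!mulA (mulC x). Qed.

Lemma pm_mulACA x y z w : (x * y) * (z * w) = (x * z) * (y * w).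
Proof. by rewrite !mulA (pm_mulCA y). Qed.

Lemma pm_mul00 : 0 * 0 = 0 :> P.
Proof. by have := mul0D 1 0; rewrite addr0 pm_mulr1. Qed.

Lemma pm_mul0K x : 0 * (0 * x) = 0 * x.
Proof. by rewrite -mulA pm_mul00. Qed.

Lemma pm_mul0M x y : 0 * (x * y) = (0 * x) * (0 * y).
Proof. by rewrite pm_mulACA pm_mul00. Qed.

Lemma pm_mul0_add x y : 0 * x + 0 * y = 0 * (x * y).
Proof. by rewrite -mulDr mul0D mulA. Qed.

Lemma pm_mul0_idem x : 0 * (x * x) = 0 * x.
Proof.
by rewrite -pm_mul0_add (mulC 0) -mulDr addr0.
Qed.

Lemma pm_mul0_absorb x y : 0 * (x * (x * y)) = 0 * (x * y).
Proof. by rewrite -(mulA x) pm_mul0M pm_mul0_idem -pm_mul0M. Qed.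

Lemma pm_mul0_1D x : 0 * (1 + 0 * x) = 0 * x.
Proof. by rewrite mul0D pm_mulr1 pm_mul0K. Qed.

Lemma pm_mul_1D x : x * (1 + 0 * x) = x.
Proof.
rewrite mulDr pm_mulCA pm_mul0_idem pm_mulr1.
by rewrite -{1}(pm_mulr1 x) (mulC 0) -mulDr addr0 pm_mulr1.
Qed.

(** [0 * (v * w) = 0 * w] is the order of the semilattice of zero elements, in
    which joins are products.  For [v = y + K] and [w = z + J] it says that [K]
    is included in [J]. *)
Definition least_inverse u v : Prop :=
  u * v = 1 + 0 * v /\
  forall w, u * w = 1 + 0 * w -> 0 * (v * w) = 0 * w.

Lemma inverse_error_ge u w : u * w = 1 + 0 * w -> 0 * (u * w) = 0 * w.
Proof. by move=> ->; exact: pm_mul0_1D. Qed.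

(** The usual argument for groups, [v = v * (u * v') = (v * u) * v' = v'], is
    available because the two error terms agree. *)
Lemma least_inverse_uniq u v v' :
  least_inverse u v -> least_inverse u v' -> v = v'.
Proof.
move=> [uv minv] [uv' minv'].
have eq0 : 0 * v = 0 * v' by rewrite -(minv' _ uv) (mulC v') (minv _ uv').
rewrite -[LHS]pm_mul_1D eq0 -uv' pm_mulCA.
by rewrite -mulA uv eq0 mulC pm_mul_1D.
Qed.

(** If [w] inverts [u * u'] with error, then [u' * w] inverts [u] with the same
    error, since the error of [w] already absorbs those of [u] and [u']. *)
Lemma inverse_mull u u' w :
  u * u' * w = 1 + 0 * w ->
  u * (u' * w) = 1 + 0 * (u' * w) /\ 0 * (u' * w) = 0 * w.
Proof.
move=> uuw; have e0 := inverse_error_ge uuw.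
suff eu' : 0 * (u' * w) = 0 * w by rewrite eu' -uuw mulA.
rewrite pm_mul0M -e0 -pm_mul0M !mulA (pm_mulCA u').
by rewrite pm_mul0M pm_mul0_absorb -pm_mul0M.
Qed.

(** Any [w] that inverts [u * u'] with error gives inverses of [u] and of [u']
    with the error of [w], so this error lies above those of [v] and [v'], hence
    above their join, the error of [v * v']. *)
Lemma least_inverseM u v u' v' :
  least_inverse u v -> least_inverse u' v' -> least_inverse (u * u') (v * v').
Proof.
move=> [uv minv] [uv' minv']; split.
  rewrite pm_mulACA uv uv' mulDr pm_mulr1 addA; congr (_ + _).
  rewrite (mulC _ (0 * v')) mulDr pm_mulr1 -pm_mul0M (pm_mul0_add v').
  by rewrite pm_mul0_absorb pm_mul0_add (mulC v') pm_mul0_absorb.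
move=> w uuw; have [h e] := inverse_mull uuw.
move: uuw; rewrite (mulC u) => /inverse_mull[h' e'].
have vw : 0 * (v * w) = 0 * w by rewrite pm_mul0M -e -pm_mul0M minv.
have v'w : 0 * (v' * w) = 0 * w by rewrite pm_mul0M -e' -pm_mul0M minv'.
by rewrite mulA pm_mul0M v'w -pm_mul0M.
Qed.

Lemma least_inverse_1D u : least_inverse (1 + 0 * u) (1 + 0 * u).
Proof.
split; first by rewrite -{2}(pm_mul0_1D u) pm_mul_1D pm_mul0_1D.
by move=> w /inverse_error_ge.
Qed.

(** If [0 * w = 1 + 0 * w], then every [x] in the fibre over [0 * w] equals
    [x * (1 + 0 * x) = x * (0 * x) = 0 * x], so this fibre is a singleton,
    which forces [0 * w = a]. *)
Lemma least_inverse0 (a : P) :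
  unique (@singleton_fiber P) a -> (forall x, x + a = a) -> least_inverse 0 a.
Proof.
move=> [[[x0 _ ax0] _] a_uniq] adda.
have a0 : 0 * a = a by rewrite -ax0 pm_mul0K.
split=> [|w w1]; first by rewrite a0 adda.
suff -> : a = 0 * w by rewrite pm_mul0M pm_mul0K -pm_mul0M pm_mul0_idem.
apply: a_uniq; split; first by exists w.
have -> : zero_fiber (0 * w) = [set 0 * w]%classic.
  apply/seteqP; split=> [x /= xw|_ ->]; last exact: pm_mul0K.
  have {}xw : 0 * x = 0 * w := xw.
  by rewrite -[LHS]pm_mul_1D xw -w1 -xw pm_mulCA pm_mul0_idem.
exact: card_set1.
Qed.

(** The axioms for [inv (x * y)], [inv (1 + 0 * x)] and [inv 0] hold because
    their right-hand sides are least inverses, and least inverses are unique. *)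
Lemma common_meadow_of_least_inverses (a : P) :
  pre_meadow_with P a -> (forall u, exists v, least_inverse u v) ->
  common_meadow P a.
Proof.
move=> pmaP ex_inv; split=> //; have [_ a_uniq adda] := pmaP.
have [inv invP] := choice ex_inv; exists inv; split=> [x|x y|x|].
- by have [] := invP x.
- by apply: least_inverse_uniq (invP _) _; exact: least_inverseM.
- by apply: least_inverse_uniq (invP _) _; exact: least_inverse_1D.
- by apply: least_inverse_uniq (invP _) _; exact: least_inverse0.
Qed.

End LeastInverses.

(** * The semilattice of ideals *)

Section Ideals.
Local Open Scope ring_scope.
Variable R : comPzRingType.
Implicit Types (I J K : ideal R) (x y a : R).

Lemma ideal_addl I J : {subset I <= ideal_add I J}.
Proof.
move=> x Ix; apply/ideal_addP; exists x => //.
by exists 0; rewrite ?rpred0 ?addr0.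
Qed.

Lemma ideal_addr I J : {subset J <= ideal_add I J}.
Proof.
move=> x Jx; apply/ideal_addP; exists 0; first exact: rpred0.
by exists x; rewrite ?add0r.
Qed.

Lemma ideal_add_sub I J K :
  {subset I <= K} -> {subset J <= K} -> {subset ideal_add I J <= K}.
Proof.
move=> IK JK _ /ideal_addP[i Ii [j Jj ->]].
by apply: rpredD; [exact: IK | exact: JK].
Qed.

Lemma ideal_sub_antisym I J : {subset I <= J} -> {subset J <= I} -> I = J.
Proof. by move=> IJ JI; apply: ideal_eq => x; apply/idP/idP => [/IJ|/JI]. Qed.

Lemma ideal_addC I J : ideal_add I J = ideal_add J I.
Proof.
by apply: ideal_sub_antisym;
  apply: ideal_add_sub => x; by [exact: ideal_addr | exact: ideal_addl].
Qed.

Lemma ideal_add_idr I J : {subset J <= I} -> ideal_add I J = I.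
Proof.
move=> JI; apply: ideal_sub_antisym; last exact: ideal_addl.
exact: ideal_add_sub.
Qed.

Lemma ideal_addA I J K :
  ideal_add (ideal_add I J) K = ideal_add I (ideal_add J K).
Proof.
apply: ideal_sub_antisym.
  apply: ideal_add_sub => [|x xK]; last by apply/ideal_addr/ideal_addr.
  apply: ideal_add_sub => x xIJ; first exact: ideal_addl.
  by apply/ideal_addr/ideal_addl.
apply: ideal_add_sub => [x xI|]; first by apply/ideal_addl/ideal_addl.
apply: ideal_add_sub => x xJK; last exact: ideal_addr.
by apply/ideal_addl/ideal_addr.
Qed.

Lemma ideal_addI I : ideal_add I I = I.
Proof. exact: ideal_add_idr. Qed.

Lemma ideal_addDr I J K :
  ideal_add I (ideal_add J K) = ideal_add (ideal_add I J) (ideal_add I K).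
Proof.
rewrite (ideal_addA I) -(ideal_addA J) (ideal_addC J I) (ideal_addA I J).
by rewrite -(ideal_addA I I) ideal_addI.
Qed.

Lemma ideal_addr0 I : ideal_add I (ideal0 R) = I.
Proof. by apply: ideal_add_idr => x /eqP ->; exact: rpred0. Qed.

Lemma ideal_add0r I : ideal_add (ideal0 R) I = I.
Proof. by rewrite ideal_addC ideal_addr0. Qed.

Lemma ideal_addr1 I : ideal_add I (ideal1 R) = ideal1 R.
Proof. by rewrite ideal_addC; exact: ideal_add_idr. Qed.

Lemma ideal_eq1 I : 1 \in I -> I = ideal1 R.
Proof.
move=> I1; apply: ideal_sub_antisym => // x _.
by rewrite -[x]mulr1; exact: ideal_mull.
Qed.

Definition principal_mem a : {pred R} := [pred x | `[< exists r, x = r * a >]].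

Fact principal_zmod a : zmod_closed (principal_mem a).
Proof.
split=> [|x y]; rewrite !inE; first by exists 0; rewrite mul0r.
by move=> [r ->] [s ->]; exists (r - s); rewrite mulrBl.
Qed.

Fact principal_mull a b :
  {in principal_mem a, forall u, b * u \in principal_mem a}.
Proof. by move=> u; rewrite !inE => -[r ->]; exists (b * r); rewrite mulrA. Qed.

Definition principal a : ideal R :=
  Ideal (principal_zmod a) (@principal_mull a).

Lemma principalP a x : reflect (exists r, x = r * a) (x \in principal a).
Proof. exact: asboolP. Qed.

(** The chain of the ideals generated by the powers of [x] stabilizes, and [r]
    comes from writing [x ^+ n] as a multiple of [x ^+ n.+1]. *)
Lemma artinian_strongly_pi_regular :
  artinian R -> forall x, exists n r, x ^+ n * (1 - x * r) = 0.
Proof.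
move=> artR x.
have [n y /principalP[r ->]|n nP] := artR (fun n => principal (x ^+ n)).
  by apply/principalP; exists (r * x); rewrite exprS mulrA.
have : x ^+ n \in principal (x ^+ n.+1).
  by rewrite (nP n.+1) ?leqnSn //; apply/principalP; exists 1; rewrite mul1r.
move=> /principalP[r xnE]; exists n, r.
by rewrite mulrBr mulr1 mulrA -exprSr mulrC -xnE subrr.
Qed.

End Ideals.

(** * The disjoint union of the quotients *)

Lemma card_eq_I1_inj (T : Type) (A : set T) (x y : T) :
  (A #= `I_1)%card -> A x -> A y -> x = y.
Proof.
move=> /card_set_bijP[f [f_fun f_inj _]] Ax Ay.
apply: f_inj; rewrite ?inE //.
by move: (f_fun x Ax) (f_fun y Ay); rewrite /= !ltnS !leqn0 => /eqP-> /eqP->.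
Qed.

Section QuotientUnion.
Local Open Scope ring_scope.
Variable R : comPzRingType.
Implicit Types (I J K : ideal R) (x y z : R) (u v w : qmeadow R).

Lemma qclass_inj I J x y :
  qclass I x = qclass J y -> I = J /\ x - y \in I.
Proof.
move=> eq_xy; split; first exact: (congr1 (fun u : qunion R => tag u) eq_xy).
have repr_y w : w = qclass J y -> repr (tagged w) - y \in tag w.
  by move=> ->; exact: repr_qclass.
set r := repr (tagged (qclass I x)).
have -> : x - y = (r - y) - (r - x) by rewrite opprB [RHS]addrC subrKA.
by rewrite rpredB ?repr_qclass //; exact: repr_y.
Qed.

Lemma qmul0E I x : qmul (mzero : qmeadow R) (qclass I x) = qclass I 0.
Proof. by rewrite qmulE ideal_add0r mul0r. Qed.

Lemma qmeadow_pre_meadow : pre_meadow (qmeadow R).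
Proof.
split=> /= [u v w|u v|u|u|u v w|u v|u|u v w|u|u v];
  have [I [x ->]] := qclassP u; rewrite ?qmul0E;
  try (have [J [y ->]] := qclassP v); try (have [K [z ->]] := qclassP w);
  rewrite ?qmul0E ?(qaddE, qoppE, qmulE).
- by rewrite ideal_addA addrA.
- by rewrite ideal_addC addrC.
- by rewrite ideal_addr0 addr0.
- by rewrite ideal_addI subrr.
- by rewrite ideal_addA mulrA.
- by rewrite ideal_addC mulrC.
- by rewrite ideal_add0r mul1r.
- by rewrite mulrDr ideal_addDr.
- by rewrite opprK.
- by rewrite mul0r.
Qed.

Lemma qmeadow_pre_meadow_with : pre_meadow_with (qmeadow R) (qmeadow_a R).
Proof.
split; first exact: qmeadow_pre_meadow; last first.
  move=> u; have [I [x ->]] := qclassP u; rewrite /= qaddE ideal_addr1.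
  exact: qclass_eq.
(* A singleton [R/I] identifies the classes of [0] and [1]. *)
have zero_fiber1 I : singleton_fiber (qclass I 0 : qmeadow R) -> I = ideal1 R.
  move=> [_ fiber1]; apply: ideal_eq1.
  have /qclass_inj[_] : qclass I 1 = qclass I 0.
    by apply: (card_eq_I1_inj fiber1); exact: qmul0E.
  by rewrite subr0.
split=> [|z z1].
  split; first by exists (qmeadow_a R) => //; exact: qmul0E.
  suff -> : zero_fiber (qmeadow_a R) = [set qmeadow_a R]%classic.
    exact: card_set1.
  apply/seteqP; split=> [u|_ ->]; last exact: qmul0E.
  have [I [x ->]] := qclassP u; rewrite /zero_fiber /= qmul0E.
  move=> /qclass_inj[-> _].
  exact: qclass_eq.
have [[u _ zE] _] := z1; have [I [x uE]] := qclassP u.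
by move: z1; rewrite -{}zE {}uE /= qmul0E => /zero_fiber1 ->.
Qed.

Lemma qmeadow_inverseP I J x z :
  qmul (qclass I x) (qclass J z) =
    qadd (mone : qmeadow R) (qmul (mzero : qmeadow R) (qclass J z)) <->
  {subset I <= J} /\ x * z - 1 \in J.
Proof.
rewrite qmul0E qmulE qaddE ideal_add0r addr0; split=> [/qclass_inj[IJ]|[IJ xz]].
  by rewrite IJ => xz; split=> // y; rewrite -IJ; exact: ideal_addl.
by rewrite ideal_addC ideal_add_idr //; exact: qclass_eq.
Qed.

(** An ideal [J] modulo which [x] is invertible contains [1 - x * r], because
    [x ^+ n * (1 - x * r) = 0] and [x] can be cancelled modulo [J].  Since [r]
    inverts [x] modulo [1 - x * r], adding this element to [I] is both necessary
    and sufficient. *)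
Lemma artinian_least_inverse :
  artinian R -> forall u, exists v, least_inverse u v.
Proof.
move=> artR u; have [I [x ->]] := qclassP u.
have [n [r xnr0]] := artinian_strongly_pi_regular artR x.
exists (qclass (ideal_add I (principal (1 - x * r))) r); split.
  apply/qmeadow_inverseP; split; first exact: ideal_addl.
  apply: ideal_addr; apply/principalP; exists (-1).
  by rewrite mulN1r opprB.
move=> w; have [J [z ->]] := qclassP w => /qmeadow_inverseP[IJ xz1].
rewrite /= qmulE !qmul0E ideal_addC ideal_add_idr //.
apply: ideal_add_sub => // _ /principalP[s ->]; apply: ideal_mull.
(* [x] can be cancelled because [y - z * (x * y)] is a multiple of
   [x * z - 1]. *)
have cancel y : x * y \in J -> y \in J.
  move=> Jxy; rewrite -[y](subrK (z * (x * y))) rpredD //.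
    2: exact: ideal_mull.
  rewrite (_ : y - _ = - y * (x * z - 1)); first exact: ideal_mull.
  by rewrite mulNr mulrBr mulr1 opprB [y * _]mulrC [x * z]mulrC mulrA.
have : x ^+ n * (1 - x * r) \in J by rewrite xnr0 rpred0.
elim: n {xnr0} => [|n IHn]; first by rewrite expr0 mul1r.
by rewrite exprS -mulrA => /cancel/IHn.
Qed.

End QuotientUnion.

Theorem theorem3p3 (R : comPzRingType) :
  pre_meadow_with (qmeadow R) (qmeadow_a R) /\
  (artinian R -> common_meadow (qmeadow R) (qmeadow_a R)).
Proof.
have pmaR := qmeadow_pre_meadow_with R; split=> // artR.
apply: common_meadow_of_least_inverses => //; first by case: pmaR.
exact: artinian_least_inverse.
Qed.
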